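(* Let $d\ge 3$, and let $X\subseteq \mathbb{S}^{d-1}$ be a spherical $s$-distance set with inner product set $A$ and cardinality $N=|X|$. Then $$\sum_{u, v, t \in A}y(u, v, t) = (N-2)\sum_{t \in A}x(t).$$ Let $\{e_u: u \in A \cup \{1\}\}$ be the standard basis of $\mathbb{R}^{s+1}$. Then for every integer $k\ge 0$ the matrix $$\begin{aligned} \mathcal{Q}^d_k(X) ={}& NQ^d_k(1, 1, 1)\, e_1e_1^{\top} \\ &+ \sum_{t \in A} x(t)\Big(Q^d_k(1, t, t)\,e_1e_t^{\top} + Q^d_k(t, 1, t)\,e_te_1^{\top} + Q^d_k(t, t, 1)\,e_te_t^{\top}\Big) \\ &+ \sum_{u, v, t \in A} y(u, v, t)Q^d_k(u, v, t)\, e_ue_v^{\top} \end{aligned}$$ is positive semidefinite.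
   Context: $\mathbb{S}^{d-1}$ is the unit sphere in $\mathbb{R}^d$. For a finite set $X\subseteq\mathbb{S}^{d-1}$ the inner product set is $A=A(X)=\{c\cdot c': c,c'\in X, c\ne c'\}$; $X$ is a spherical $s$-distance set if $|A(X)|=s$. Distance distributions: $x(t)=\#\{(c,c')\in X^2: c\cdot c'=t\}$ and $y(u,v,t)=\#\{(b,c,c')\in X^3: b\cdot c=u,\ b\cdot c'=v,\ c\cdot c'=t\}$. Gegenbauer polynomials $P^n_k$ ($n\ge2$): $P^n_0(t)=1$, $P^n_1(t)=t$, and $P^n_k(t)=\frac{1}{k+n-3}\big((2k+n-4)\,t\,P^n_{k-1}(t)-(k-1)P^n_{k-2}(t)\big)$ for $k\ge2$. Define $$Q^d_k(u,v,t)=(1-u^2)^{k/2}(1-v^2)^{k/2}P^{d-1}_k\left(\frac{t-uv}{\sqrt{(1-u^2)(1-v^2)}}\right),$$ which is a polynomial in $u,v,t$ (because $P^{d-1}_k$ has the parity of $k$) and is evaluated as such, in particular when $u=\pm1$ or $v=\pm1$. *)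

(* Defs.v *)
From mathcomp Require Import all_boot all_order all_algebra finmap reals.

Set Implicit Arguments.
Unset Strict Implicit.
Unset Printing Implicit Defensive.

Import Order.TTheory GRing.Theory Num.Theory.
Local Open Scope ring_scope.
Local Open Scope fset_scope.

Definition dot (R : realType) (d : nat) (c c' : 'rV[R]_d) : R :=
  \sum_(i < d) c 0 i * c' 0 i.

Definition unit_sphere (R : realType) (d : nat) : pred 'rV[R]_d :=
  [pred c | dot c c == 1].

Definition inner_products (R : realType) (d : nat) (X : {fset 'rV[R]_d}) :
    {fset R} :=
  [fset dot p.1 p.2 | p in X `*` X & p.1 != p.2].

Definition spherical_distance_set (R : realType) (d s : nat)
    (X : {fset 'rV[R]_d}) : Prop :=
  (forall c, c \in X -> c \in @unit_sphere R d) /\ #|` inner_products X| = s.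

Definition pair_count (R : realType) (d : nat) (X : {fset 'rV[R]_d}) (t : R) :
    nat :=
  #|` [fset p in X `*` X | dot p.1 p.2 == t]|.

(* An element p of (X * X) * X encodes (b, c, c') = (p.1.1, p.1.2, p.2). *)
Definition triple_count (R : realType) (d : nat) (X : {fset 'rV[R]_d})
    (u v t : R) : nat :=
  #|` [fset p in (X `*` X) `*` X | [&& dot p.1.1 p.1.2 == u,
                                       dot p.1.1 p.2 == v &
                                       dot p.1.2 p.2 == t]]|.

Fixpoint gegenbauer (R : realType) (n k : nat) : {poly R} :=
  match k with
  | 0 => 1
  | k1.+1 =>
    match k1 with
    | 0 => 'X
    | k2.+1 =>
      (k%:R + n%:R - 3)^-1 *:
        ((2 * k%:R + n%:R - 4) *: ('X * gegenbauer R n k1)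
         - (k%:R - 1) *: gegenbauer R n k2)
    end
  end.

(* The polynomial in u, v, t obtained by expanding
     (1 - u^2)^(k/2) (1 - v^2)^(k/2)
       P^(d-1)_k ((t - u v) / sqrt ((1 - u^2) (1 - v^2)))
   coefficient by coefficient.  By parity of P^(d-1)_k (gegenbauer_parity) only
   the j with k - j even contribute, so the halving is exact; zonalE below is
   the agreement with the closed formula. *)
Definition zonal (R : realType) (d k : nat) (u v t : R) : R :=
  \sum_(j < k.+1) (gegenbauer R d.-1 k)`_j * (t - u * v) ^+ j
                  * ((1 - u ^+ 2) * (1 - v ^+ 2)) ^+ (k - j)./2.

Definition psdmx (R : realType) (m : nat) (M : 'M[R]_m) : Prop :=
  M^T = M /\ forall z : 'cV[R]_m, 0 <= (z^T *m M *m z) 0 0.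

Lemma gegenbauerSS (R : realType) (n k : nat) :
  gegenbauer R n k.+2 =
    (k.+2%:R + n%:R - 3)^-1 *:
      ((2 * k.+2%:R + n%:R - 4) *: ('X * gegenbauer R n k.+1)
       - (k.+2%:R - 1) *: gegenbauer R n k).
Proof. by []. Qed.

Lemma size_gegenbauer (R : realType) (n k : nat) :
  (size (gegenbauer R n k) <= k.+1)%N.
Proof.
suff: (size (gegenbauer R n k) <= k.+1)%N /\
      (size (gegenbauer R n k.+1) <= k.+2)%N by case.
elim: k => [|k [IH0 IH1]]; first by rewrite size_poly1 size_polyX.
split=> //; rewrite gegenbauerSS.
apply: (leq_trans (size_scale_leq _ _)).
apply: (leq_trans (size_polyD _ _)); rewrite size_polyN geq_max.
apply/andP; split; apply: (leq_trans (size_scale_leq _ _)).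
  by rewrite (leq_trans (size_polyMleq _ _)) // size_polyX add2n.
by apply: leq_trans IH0 _; rewrite -addn2 leq_addr.
Qed.

Lemma gegenbauer_parity (R : realType) (n k j : nat) :
  odd k != odd j -> (gegenbauer R n k)`_j = 0.
Proof.
suff: (forall j, odd k != odd j -> (gegenbauer R n k)`_j = 0) /\
      (forall j, odd k.+1 != odd j -> (gegenbauer R n k.+1)`_j = 0).
  by case=> H _; apply: H.
elim: k {j} => [|k [IH0 IH1]].
  split=> j; first by rewrite coef1; case: j.
  by rewrite coefX; case: j => [|[|j]].
split=> // j; rewrite gegenbauerSS coefZ coefB !coefZ coefXM /= negbK => hj.
rewrite (IH0 j) // mulr0 subr0.
case: j hj => [|j] hj /=; first by rewrite !mulr0.
by rewrite IH1 ?mulr0 //=; move: hj => /=; case: (odd k); case: (odd j).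
Qed.

Lemma zonalE (R : realType) (d k : nat) (u v t : R) :
  u ^+ 2 < 1 -> v ^+ 2 < 1 ->
  zonal d k u v t =
    Num.sqrt (1 - u ^+ 2) ^+ k * Num.sqrt (1 - v ^+ 2) ^+ k *
    (gegenbauer R d.-1 k).[(t - u * v) /
                           Num.sqrt ((1 - u ^+ 2) * (1 - v ^+ 2))].
Proof.
rewrite -subr_gt0 => u1; rewrite -subr_gt0 => v1; rewrite /zonal.
set w := (1 - u ^+ 2) * (1 - v ^+ 2).
have w0 : 0 < w by rewrite mulr_gt0.
rewrite -exprMn -sqrtrM ?ltW // -/w.
have s0 : Num.sqrt w != 0 by rewrite gt_eqF ?sqrtr_gt0.
rewrite (horner_coef_wide _ (size_gegenbauer R d.-1 k)) mulr_sumr.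
apply: eq_bigr => j _.
have [kj|kj] := eqVneq (odd k) (odd j); last first.
  by rewrite gegenbauer_parity // !mul0r mulr0.
have jk : (j <= k)%N by rewrite -ltnS.
rewrite -{1}(sqr_sqrtr (ltW w0)) -exprM mul2n even_halfK; last first.
  by rewrite oddB // kj addbb.
rewrite expr_div_n mulrCA -!mulrA; congr (_ * _).
rewrite mulrCA; congr (_ * _).
by rewrite expfB_cond // (negPf s0).
Qed.

(* Main.v *)
Require Import Defs.
From mathcomp Require Import all_boot all_order all_algebra finmap reals.
From mathcomp Require Import mpoly ring.
Import Order.TTheory GRing.Theory Num.Theory.
Local Open Scope ring_scope.

Set Implicit Arguments.
Unset Strict Implicit.
Unset Printing Implicit Defensive.

(** Why the theorem holds.

    Two distinct unit vectors never have inner product 1, so the inner product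
    of two points of X lies in A exactly when the points differ.  A sum over A
    weighted by the pair or triple counts is therefore a sum over pairs or
    triples of pairwise distinct points ([sum_pair_count],
    [sum_triple_count]).  The identity counts the N - 2 points that remain once
    two are chosen.  For the matrix, sorting the triples (b, c, c') by which of
    their entries coincide ([sum_triple_split]) collects the three groups of
    terms into the sum, over all triples of points, of
      Q (b.c, b.c', c.c') e_(b.c) e_(b.c')^T.
    The quadratic form of this matrix is a sum over b, so it is enough that for
    each unit vector b the kernel (c, c') |-> Q (b.c, b.c', c.c') on the sphere
    is positive semidefinite ([zonal_kernel_psd]).

    This kernel is a Gram kernel.  Let w = c - (b.c) b be the projection of c
    onto the hyperplane orthogonal to b, let l be the linear form x |-> x.w,
    and let rho(x) = |x|^2 - (b.x)^2 be the squared distance to the axis of b.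
    Running the Gegenbauer recurrence for n = d - 1, homogenized by
    t = |w|^2 rho, gives a form G_w of degree k whose value at the projection of
    another unit vector c' is Q.  It is constant along b, and it is harmonic:
    differentiating the recurrence along w shows by induction that
    d_w G_(w,k) = k |w|^2 G_(w,k-1) ([ddir_solid]), and this is just what cancels
    the two terms that the Laplacian produces in the recurrence.

    On polynomials, the Fischer product pairs p with q by applying p(d/dx) to q.
    It is positive, multiplication by rho is adjoint to the Laplacian of the
    hyperplane, and pairing with l^k evaluates a form of degree k at w.  Since
    G_w is a positive multiple of l^k plus a multiple of rho ([solid_lead]),
    pairing G_w with the harmonic form G_w' gives a positive multiple of
    G_w'(w) ([zonal_solid_gram]). *)

(** * Vector fields and the Laplacian on polynomials *)

Section VectorFields.
Variables (R : comNzRingType) (d : nat).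
Implicit Types (a : 'I_d -> {mpoly R[d]}) (p q : {mpoly R[d]}).
Implicit Types (b v w : 'rV[R]_d).

(** Euler's operator and all directional derivatives are polynomial vector
    fields, so the Leibniz rule is proved once for this class. *)
Definition vfield a p : {mpoly R[d]} := \sum_i a i * p^`M(i).

Definition ddir w := vfield (fun i => (w 0 i)%:MP).

Definition euler := vfield (fun i => 'X_i).

Definition laplacian p : {mpoly R[d]} := \sum_i p^`M(i)^`M(i).

Definition linform w : {mpoly R[d]} := \sum_i (w 0 i)%:MP * 'X_i.

Definition sqnorm : {mpoly R[d]} := \sum_i 'X_i ^+ 2.

(** For a unit vector b, the squared distance to the line spanned by b. *)
Definition axial_sqdist b : {mpoly R[d]} := sqnorm - linform b ^+ 2.

Lemma mderivXU i j : ('X_j : {mpoly R[d]})^`M(i) = (i == j)%:R%:MP.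
Proof.
rewrite mderivX mnm1E eq_sym; case: eqVneq => [->|_]; last by rewrite scale0r mpolyC0.
by rewrite scale1r -{1}[U_(j)%MM]add0m addmK mpolyX0 mpolyC1.
Qed.

Lemma vfieldM a p q : vfield a (p * q) = vfield a p * q + p * vfield a q.
Proof.
rewrite /vfield mulr_suml mulr_sumr -big_split /=.
by apply: eq_bigr => i _; rewrite mderivM; ring.
Qed.

Lemma vfieldC a c : vfield a c%:MP = 0.
Proof. by rewrite /vfield big1 // => i _; rewrite mderivC mulr0. Qed.

Lemma vfield1 a : vfield a 1 = 0.
Proof. by rewrite -mpolyC1 vfieldC. Qed.

Lemma vfieldB a p q : vfield a (p - q) = vfield a p - vfield a q.
Proof.
rewrite /vfield -sumrB; apply: eq_bigr => i _; by rewrite mderivB mulrBr.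
Qed.

Lemma vfieldXU a i : vfield a 'X_i = a i.
Proof.
rewrite /vfield (bigD1 i) //= mderivXU eqxx mpolyC1 mulr1 big1 ?addr0 // => j ji.
by rewrite mderivXU (negPf ji) mpolyC0 mulr0.
Qed.

Lemma vfield_sum a (I : Type) (s : seq I) (F : I -> {mpoly R[d]}) :
  vfield a (\sum_(i <- s) F i) = \sum_(i <- s) vfield a (F i).
Proof.
rewrite /vfield exchange_big /=; apply: eq_bigr => i _.
by rewrite (raddf_sum (mderiv i)) mulr_sumr.
Qed.

Lemma vfield_linform a w : vfield a (linform w) = \sum_i (w 0 i)%:MP * a i.
Proof.
rewrite vfield_sum; apply: eq_bigr => i _.
by rewrite vfieldM vfieldC vfieldXU mul0r add0r.
Qed.

Lemma vfield_sqnorm a : vfield a sqnorm = 2 * \sum_i a i * 'X_i.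
Proof.
rewrite vfield_sum mulr_sumr; apply: eq_bigr => i _.
by rewrite expr2 vfieldM vfieldXU; ring.
Qed.

Lemma mderiv_linform w i : (linform w)^`M(i) = (w 0 i)%:MP.
Proof.
rewrite /linform (raddf_sum (mderiv i)) (bigD1 i) //= mderiv_mulC mderivXU eqxx.
rewrite mpolyC1 mulr1 big1 ?addr0 // => j ji.
by rewrite mderiv_mulC mderivXU eq_sym (negPf ji) mpolyC0 mulr0.
Qed.

Lemma mderiv_sqnorm i : sqnorm^`M(i) = 2 * 'X_i.
Proof.
rewrite /sqnorm (raddf_sum (mderiv i)) (bigD1 i) //= expr2 mderivM mderivXU eqxx.
rewrite mpolyC1 big1 ?addr0 => [|j ji]; first by ring.
by rewrite expr2 mderivM mderivXU eq_sym (negPf ji) mpolyC0; ring.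
Qed.

Lemma mderiv_linform_grad w p :
  \sum_i (linform w)^`M(i) * p^`M(i) = ddir w p.
Proof. by apply: eq_bigr => i _; rewrite mderiv_linform. Qed.

Lemma laplacianB p q : laplacian (p - q) = laplacian p - laplacian q.
Proof.
by rewrite /laplacian -sumrB; apply: eq_bigr => i _; rewrite !mderivB.
Qed.

Lemma laplacianM p q :
  laplacian (p * q) =
    p * laplacian q + 2 * (\sum_i p^`M(i) * q^`M(i)) + q * laplacian p.
Proof.
rewrite /laplacian !mulr_sumr -!big_split /=; apply: eq_bigr => i _.
by rewrite mderivM mderivD !mderivM; ring.
Qed.

Lemma laplacianZ c p : laplacian (c%:MP * p) = c%:MP * laplacian p.
Proof.
by rewrite /laplacian mulr_sumr; apply: eq_bigr => i _; rewrite !mderiv_mulC.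
Qed.

Lemma laplacian_linform w : laplacian (linform w) = 0.
Proof. by rewrite /laplacian big1 // => i _; rewrite mderiv_linform mderivC. Qed.

(** Differentiation lowers the degree of homogeneity by one. *)
Lemma euler_mderiv i p : euler p^`M(i) = (euler p)^`M(i) - p^`M(i).
Proof.
have -> : p^`M(i) = \sum_j (i == j)%:R%:MP * p^`M(j).
  rewrite (bigD1 i) //= eqxx mpolyC1 mul1r big1 ?addr0 // => j ji.
  by rewrite eq_sym (negPf ji) mpolyC0 mul0r.
rewrite /euler vfield_sum /vfield (raddf_sum (mderiv i)) -sumrB /=.
under eq_bigr => j _ do
  under eq_bigr => l _ do rewrite mderiv_mulC mulrCA.
rewrite exchange_big; apply: eq_bigr => j _ /=.
rewrite mderivM mderivXU (addrC (_ * _)) addrK (bigD1 i) //= eqxx mpolyC1 mul1r.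
rewrite mderiv_comm big1 ?addr0 // => l li.
by rewrite eq_sym (negPf li) mpolyC0 mul0r.
Qed.

(** Each monomial is an eigenvector of Euler's operator, so homogeneity can be
    read off the coefficients. *)
Lemma mcoeff_euler m p : (euler p)@_m = (mdeg m)%:R * p@_m.
Proof.
have E q : euler q = \sum_(m0 <- msupp q) q@_m0 *: ((mdeg m0)%:R *: 'X_[m0]).
  rewrite {1}[q]mpolyE /euler vfield_sum; apply: eq_bigr => m0 _.
  rewrite -mul_mpolyC vfieldM vfieldC mul0r add0r mul_mpolyC; congr (_ *: _).
  rewrite /vfield mdegE natr_sum scaler_suml; apply: eq_bigr => i _.
  rewrite mderivX -scalerAr -mpolyXD; case: (posnP (m0 i)) => [->|mi].
    by rewrite !scale0r.
  by rewrite addmC submK // lep1mP -lt0n.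
rewrite E raddf_sum /=.
under eq_bigr => m0 _ do rewrite !mcoeffZ mcoeffX.
case: (boolP (m \in msupp p)) => mp.
  rewrite (bigD1_seq m) ?msupp_uniq //= eqxx mulr1 mulrC big1 ?addr0 // => m0.
  by move=> /negPf ->; rewrite !mulr0.
rewrite [in RHS]memN_msupp_eq0 // mulr0 big1_seq // => m0 /andP[_ m0p].
by case: eqP => [e|_]; rewrite ?mulr0 //; rewrite -e m0p in mp.
Qed.

End VectorFields.

(** * The Fischer product *)

Section Fischer.
Variables (R : realFieldType) (d : nat).
Implicit Types (p q : {mpoly R[d]}) (b v w : 'rV[R]_d).

(** On forms of degree k this is k! times the classical Fischer product, in
    which distinct monomials are orthogonal and a monomial with exponents m has
    squared norm m!.  The recursive form makes positivity immediate, and the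
    factor k! is harmless because only signs matter. *)
Fixpoint fischer (k : nat) p q : R :=
  if k is j.+1 then \sum_i fischer j p^`M(i) q^`M(i)
  else p.@[fun=> 0] * q.@[fun=> 0].

Lemma fischerS k p q :
  fischer k.+1 p q = \sum_i fischer k p^`M(i) q^`M(i).
Proof. by []. Qed.

Lemma fischerC k p q : fischer k p q = fischer k q p.
Proof.
elim: k p q => [|k IH] p q /=; first exact: mulrC.
by apply: eq_bigr => i _; exact: IH.
Qed.

Lemma fischer_ge0 k p : 0 <= fischer k p p.
Proof.
elim: k p => [|k IH] p /=; first exact: sqr_ge0.
by apply: sumr_ge0 => i _; exact: IH.
Qed.

Lemma fischerDl k p1 p2 q :
  fischer k (p1 + p2) q = fischer k p1 q + fischer k p2 q.
Proof.
elim: k p1 p2 q => [|k IH] p1 p2 q /=; first by rewrite mevalD mulrDl.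
by rewrite -big_split /=; apply: eq_bigr => i _; rewrite mderivD IH.
Qed.

Lemma fischerZl k c p q : fischer k (c%:MP * p) q = c * fischer k p q.
Proof.
elim: k p q => [|k IH] p q /=; first by rewrite mevalM mevalC mulrA.
by rewrite mulr_sumr; apply: eq_bigr => i _; rewrite mderiv_mulC IH.
Qed.

Lemma fischer0l k q : fischer k 0 q = 0.
Proof. by rewrite -[0](mul0r 0) -[X in X * _]mpolyC0 fischerZl mul0r. Qed.

Lemma fischer_suml k (I : Type) (s : seq I) (F : I -> {mpoly R[d]}) q :
  fischer k (\sum_(i <- s) F i) q = \sum_(i <- s) fischer k (F i) q.
Proof.
elim/big_rec2: _ => [|i y x _ <-]; first exact: fischer0l.
exact: fischerDl.
Qed.

Lemma fischer_mulX0 i p q : fischer 0 ('X_i * p) q = 0.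
Proof. by rewrite /= mevalM mevalXU !mul0r. Qed.

(** Multiplication by a variable is adjoint to differentiation.  The factor k + 1
    has two sources: the Leibniz term in which the variable itself is
    differentiated contributes 1, and the induction hypothesis contributes k. *)
Lemma fischer_mulX k i p q :
  fischer k.+1 ('X_i * p) q = k.+1%:R * fischer k p q^`M(i).
Proof.
elim: k p q => [|k IH] p q.
  rewrite /= mul1r (bigD1 i) //= mderivM mderivXU eqxx mpolyC1 mul1r.
  rewrite mevalD mevalM mevalXU mul0r addr0 big1 ?addr0 // => j ji.
  rewrite mderivM mderivXU (negPf ji) mpolyC0 mul0r add0r mevalM mevalXU.
  by rewrite !mul0r.
rewrite fischerS.
under eq_bigr => j _.
  rewrite mderivM mderivXU fischerDl fischerZl IH mderiv_comm.
  over.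
rewrite big_split -mulr_sumr -fischerS.
rewrite (bigD1 i) // eqxx mul1r big1 => [|j ji]; last first.
  by rewrite (negPf ji) mul0r.
by rewrite -[LHS]/(_ + 0 + _) addr0 -[in RHS]natr1; ring.
Qed.

Lemma fischer_linform k w p q :
  fischer k.+1 (linform w * p) q = k.+1%:R * fischer k p (ddir w q).
Proof.
rewrite /linform mulr_suml fischer_suml fischerC.
rewrite /ddir /vfield fischerC (fischerC k) fischer_suml mulr_sumr.
apply: eq_bigr => i _; rewrite -mulrA !fischerZl fischer_mulX (fischerC k).
by ring.
Qed.

(** Multiplication by the squared distance to the axis b is adjoint, up to a
    factor, to the Laplacian minus the second derivative along b, so a polynomial
    killed by both the Laplacian and the derivative along b is orthogonal to all
    multiples of that squared distance. *)
Lemma fischer_harmonic k b p q : laplacian q = 0 -> ddir b q = 0 ->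
  fischer k (axial_sqdist b * p) q = 0.
Proof.
move=> hq bq.
have -> : axial_sqdist b * p =
    \sum_i 'X_i * ('X_i * p) + (-1)%:MP * (linform b * (linform b * p)).
  rewrite mpolyCN mpolyC1 /axial_sqdist /sqnorm mulrBl mulr_suml expr2 mulN1r !mulrA.
  by congr (_ - _); apply: eq_bigr => i _; rewrite expr2 mulrA.
rewrite fischerDl fischerZl fischer_suml.
case: k => [|k].
  rewrite big1 => [|i _]; last by rewrite fischer_mulX0.
  rewrite /linform mulr_suml fischer_suml big1 ?mulr0 ?addr0 // => i _.
  by rewrite -mulrA fischerZl fischer_mulX0 mulr0.
rewrite fischer_linform bq fischerC fischer0l !mulr0 addr0.
under eq_bigr do rewrite fischer_mulX.
case: k => [|k].
  by rewrite big1 // => i _; rewrite fischer_mulX0 mulr0.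
under eq_bigr do rewrite fischer_mulX fischerC.
by rewrite -!mulr_sumr -fischer_suml -/(laplacian q) hq fischer0l !mulr0.
Qed.

Lemma euler0_const q : euler q = 0 -> q = (q@_0%MM)%:MP.
Proof.
move=> eq0; apply/mpolyP => m; rewrite mcoeffC.
have [->|m0] := eqVneq 0%MM m; first by rewrite mulr1.
rewrite mulr0; have /eqP := mcoeff_euler m q.
rewrite eq0 mcoeff0 eq_sym mulf_eq0 pnatr_eq0 mdeg_eq0 => /orP[|/eqP //].
by rewrite eq_sym (negPf m0).
Qed.

(** The k-th power of a linear form reproduces values: moving its k factors to
    the other side applies the k-th directional derivative along w, and by
    Euler's relation each derivative of a form, evaluated at w itself, just
    multiplies the value by the current degree.  One factor k! comes from the
    degrees and the other from the normalization of the product. *)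
Lemma fischer_linform_pow k w q : euler q = k%:R%:MP * q ->
  fischer k (linform w ^+ k) q = k`!%:R ^+ 2 * q.@[w 0].
Proof.
elim: k q => [|k IH] q hq.
  rewrite /= meval1 (@euler0_const q); last by rewrite hq mpolyC0 mul0r.
  by rewrite !mevalC fact0 expr1n.
rewrite exprS fischer_linform fischerC fischer_suml.
under eq_bigr => i _.
  rewrite fischerZl fischerC IH; last first.
    rewrite euler_mderiv hq mderiv_mulC -[X in X%:MP]natr1 mpolyCD mpolyC1.
    by ring.
  over.
have := congr1 (meval (w 0)) hq.
rewrite mevalM mevalC /euler /vfield (raddf_sum (meval (w 0))) /=.
under eq_bigr do rewrite mevalM mevalXU.
move=> hw; rewrite factS natrM.
transitivity (k.+1%:R * (k`!%:R ^+ 2 * (k.+1%:R * q.@[w 0]))); last by ring.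
rewrite -hw; congr (_ * _); rewrite mulr_sumr; apply: eq_bigr => i _.
by rewrite mulrCA.
Qed.

End Fischer.

(** * Homogenized Gegenbauer polynomials *)

Section SolidGegenbauer.
Variables (R : realType) (d n : nat).
Implicit Types (l t p : {mpoly R[d]}).

(** The Gegenbauer polynomial made homogeneous: with l of weight 1 and t of
    weight 2, this is t^(k/2) P_k (l / sqrt t).  It is built from the recurrence
    rather than from coefficients because the differential identities below are
    inductions along that recurrence. *)
Fixpoint solid l t (k : nat) : {mpoly R[d]} :=
  match k with
  | 0 => 1
  | k1.+1 =>
    match k1 with
    | 0 => l
    | k2.+1 =>
      ((k%:R + n%:R - 3)^-1)%:MP *
        ((2 * k%:R + n%:R - 4)%:MP * (l * solid l t k1)
         - (k%:R - 1)%:MP * (t * solid l t k2))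
    end
  end.

Lemma solidSS l t k :
  solid l t k.+2 =
    ((k.+2%:R + n%:R - 3)^-1)%:MP *
      ((2 * k.+2%:R + n%:R - 4)%:MP * (l * solid l t k.+1)
       - (k.+2%:R - 1)%:MP * (t * solid l t k)).
Proof. by []. Qed.

Hypothesis n_ge2 : (2 <= n)%N.

Lemma solid_denom_gt0 k : 0 < k.+2%:R + n%:R - 3 :> R.
Proof.
have -> : k.+2%:R + n%:R - 3 = k%:R + (n - 1)%N%:R :> R.
  by rewrite natrB 1?ltnW // -addn2 natrD; ring.
by rewrite ltr_wpDl ?ler0n // ltr0n subn_gt0.
Qed.

Lemma solid_rec l t k :
  (k%:R + n%:R - 1)%:MP * solid l t k.+2 =
    (2 * k%:R + n%:R)%:MP * (l * solid l t k.+1) - (k%:R + 1)%:MP * (t * solid l t k).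
Proof.
have D0 := lt0r_neq0 (solid_denom_gt0 k).
have e : k.+2%:R = k%:R + 2 :> R by rewrite -addn2 natrD.
rewrite solidSS.
have -> : k%:R + n%:R - 1 = k.+2%:R + n%:R - 3 :> R by rewrite e; ring.
rewrite [LHS]mulrA -mpolyCM divff // mpolyC1 mul1r.
by congr (_%:MP * _ - _%:MP * _); rewrite e; ring.
Qed.

Lemma solid_denomI k p q :
  (k%:R + n%:R - 1 : R)%:MP * p = (k%:R + n%:R - 1)%:MP * q -> p = q.
Proof.
apply: mulfI; rewrite mpolyC_eq0 gt_eqF //.
by have := solid_denom_gt0 k; rewrite -addn2 natrD; congr (0 < _); ring.
Qed.

Lemma vfield_solid0 a l t k :
  vfield a l = 0 -> vfield a t = 0 -> vfield a (solid l t k) = 0.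
Proof.
move=> al at0; have a1 : vfield a 1 = 0 by exact: vfield1.
suff: vfield a (solid l t k) = 0 /\ vfield a (solid l t k.+1) = 0 by case.
elim: k => [|k [IH0 IH1]]; first by [].
split=> //; rewrite solidSS !(vfieldM, vfieldB, vfieldC) al at0 IH0 IH1.
by rewrite !(mulr0, mul0r, addr0, subr0).
Qed.

Lemma euler_solid l t k : euler l = l -> euler t = 2 * t ->
  euler (solid l t k) = k%:R%:MP * solid l t k.
Proof.
move=> el et; have e1 : euler (1 : {mpoly R[d]}) = 0 by exact: vfield1.
suff: euler (solid l t k) = k%:R%:MP * solid l t k /\
      euler (solid l t k.+1) = k.+1%:R%:MP * solid l t k.+1 by case.
elim: k => [|k [IH0 IH1]].
  by rewrite /= e1 el mpolyC0 mpolyC1 mul0r mul1r.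
split=> //; rewrite /euler solidSS !(vfieldM, vfieldB, vfieldC) -!/(euler _).
rewrite el et IH0 IH1; ring.
Qed.

(** The hypotheses hold when l is the linear form of w, s = |w|^2, and t is s
    times the squared distance to an axis orthogonal to w.  The derivative of
    the recurrence for degree k + 2 then involves the degrees k + 1, k and
    k - 1, and the terms of degrees k and k - 1 combine by the recurrence into
    one of degree k + 1. *)
Lemma ddir_solid w l t (s : R) k :
  ddir w l = s%:MP -> ddir w t = 2 * s%:MP * l ->
  ddir w (solid l t k.+1) = (k.+1%:R * s)%:MP * solid l t k.
Proof.
move=> wl wt; have w1 : ddir w 1 = 0 by exact: vfield1.
suff: ddir w (solid l t k.+1) = (k.+1%:R * s)%:MP * solid l t k /\
      ddir w (solid l t k.+2) = (k.+2%:R * s)%:MP * solid l t k.+1 by case.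
(* Stated with an unknown derivative g of the term of degree j, so that it
   covers j = 0, where that derivative vanishes. *)
have step j g : ddir w (solid l t j) = g ->
   ddir w (solid l t j.+1) = (j.+1%:R * s)%:MP * solid l t j ->
   (j%:R + n%:R - 1)%:MP * ddir w (solid l t j.+2) =
   (2 * j%:R + n%:R)%:MP * (s%:MP * solid l t j.+1 + l * ((j.+1%:R * s)%:MP * solid l t j))
   - (j%:R + 1)%:MP * (2 * s%:MP * l * solid l t j + t * g).
  move=> h0 h1; have := congr1 (ddir w) (solid_rec l t j).
  by rewrite /ddir !(vfieldM, vfieldB, vfieldC) -!/(ddir w _) wl wt h0 h1 !mul0r !add0r.
elim: k => [|k [IH0 IH1]].
  have h1 : ddir w (solid l t 1) = (1%:R * s)%:MP * solid l t 0.
    by rewrite /= wl mul1r mulr1.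
  split=> //; apply: (@solid_denomI 0); rewrite (step 0 _ w1 h1) /=.
  by rewrite !(mpolyCD, mpolyC1, mpolyCM, mpolyCB); ring.
split=> //; apply: (@solid_denomI k.+1); rewrite (step _ _ IH0 IH1).
have := solid_rec l t k.
set g0 := solid l t k; set g1 := solid l t k.+1; set g2 := solid l t k.+2 => E.
transitivity ((2 * k.+1%:R + n%:R)%:MP * (s%:MP * g2) + ((k%:R + 2) * s)%:MP *
   ((2 * k%:R + n%:R)%:MP * (l * g1) - (k%:R + 1)%:MP * (t * g0))).
  by ring.
by rewrite -E; ring.
Qed.

(** Modulo t the recurrence only multiplies by l and a constant that is positive
    for n >= 2. *)
Lemma solid_lead k : exists2 c : R, 0 < c &
  forall l t, exists r, solid l t k = c%:MP * l ^+ k + t * r.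
Proof.
case: k => [|k].
  by exists 1 => // l t; exists 0; rewrite /= mpolyC1; ring.
elim: k => [|k [c c0 IH]].
  by exists 1 => // l t; exists 0; rewrite /= mpolyC1; ring.
set D := (k.+2%:R + n%:R - 3)^-1 : R; set a := 2 * k.+2%:R + n%:R - 4 : R.
exists (D * a * c) => [|l t].
  rewrite !mulr_gt0 ?invr_gt0 ?solid_denom_gt0 //.
  have -> : a = (2 * k + n)%N%:R by rewrite /a; ring.
  by rewrite ltr0n addn_gt0 (ltnW n_ge2) orbT.
have [r E] := IH l t.
exists (D%:MP * (a%:MP * (l * r) - (k.+2%:R - 1)%:MP * solid l t k)).
by rewrite solidSS E -/D -/a [in RHS]exprS; ring.
Qed.

(** The right-hand side is the shape in which [zonal] expands the Gegenbauer
    polynomial; both sides obey the same recurrence. *)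
Lemma meval_solid l t (x : 'I_d -> R) k :
  (solid l t k).@[x] =
    \sum_(j < k.+1) (gegenbauer R n k)`_j * l.@[x] ^+ j * t.@[x] ^+ (k - j)./2.
Proof.
pose H k := \sum_(j < k.+1)
  (gegenbauer R n k)`_j * l.@[x] ^+ j * t.@[x] ^+ (k - j)./2.
suff: (solid l t k).@[x] = H k /\ (solid l t k.+1).@[x] = H k.+1 by case.
elim: k => [|k [IH0 IH1]].
  split; first by rewrite /H big_ord1 /= coef1 meval1 !expr0 !mulr1.
  by rewrite /H big_ord_recl big_ord1 /= !coefX /=; ring.
split=> //; rewrite solidSS !(mevalM, mevalB, mevalC) IH0 IH1.
have -> : l.@[x] * H k.+1 = \sum_(j < k.+3)
    ('X * gegenbauer R n k.+1)`_j * l.@[x] ^+ j * t.@[x] ^+ (k.+2 - j)./2.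
  rewrite big_ord_recl coefXM /= !mul0r add0r mulr_sumr.
  by apply: eq_bigr => j _; rewrite coefXM /= subSS exprS; ring.
have -> : t.@[x] * H k = \sum_(j < k.+3)
    (gegenbauer R n k)`_j * l.@[x] ^+ j * t.@[x] ^+ (k.+2 - j)./2.
  have g0 j : (k < j)%N -> (gegenbauer R n k)`_j = 0.
    by move=> kj; apply: nth_default; apply: leq_trans kj; exact: size_gegenbauer.
  rewrite [RHS]big_ord_recr /= [X in X + _]big_ord_recr /= !g0 // !mul0r !addr0 mulr_sumr.
  apply: eq_bigr => j _; rewrite -addn2 -addnBAC 1?addn2 -1?ltnS //= exprS.
  by ring.
rewrite !mulr_sumr -sumrB mulr_sumr; apply: eq_bigr => j _.
by rewrite gegenbauerSS coefZ coefB !coefZ; ring.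
Qed.

End SolidGegenbauer.

(** * Positivity of the zonal kernel *)

Section ZonalKernel.
Variables (R : realType) (d : nat).
Implicit Types (p : {mpoly R[d]}) (b c v w : 'rV[R]_d).

Lemma dotC v w : dot v w = dot w v.
Proof. by apply: eq_bigr => i _; rewrite mulrC. Qed.

Lemma dotBl u v w : dot (u - v) w = dot u w - dot v w.
Proof. by rewrite /dot -sumrB; apply: eq_bigr => i _; rewrite !mxE mulrBl. Qed.

Lemma dotZl a v w : dot (a *: v) w = a * dot v w.
Proof. by rewrite /dot mulr_sumr; apply: eq_bigr => i _; rewrite !mxE mulrA. Qed.

Definition orthoproj b c : 'rV[R]_d := c - dot b c *: b.

Lemma dot_orthoproj b c v : dot b b = 1 ->
  dot (orthoproj b c) (orthoproj b v) = dot c v - dot b c * dot b v.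
Proof.
move=> b1; rewrite /orthoproj dotBl dotZl ![dot _ (v - _)]dotC !dotBl !dotZl b1.
by rewrite (dotC v c) (dotC v b); ring.
Qed.

Lemma dot_axis_orthoproj b c : dot b b = 1 -> dot b (orthoproj b c) = 0.
Proof. by move=> b1; rewrite dotC dotBl dotZl b1 (dotC c b) mulr1 subrr. Qed.

Lemma meval_linform v w : (linform w).@[v 0] = dot w v.
Proof.
rewrite /linform (raddf_sum (meval _)) /=; apply: eq_bigr => i _.
by rewrite mevalM mevalC mevalXU.
Qed.

Lemma meval_axial_sqdist b v :
  (axial_sqdist b).@[v 0] = dot v v - dot b v ^+ 2.
Proof.
rewrite /axial_sqdist mevalB expr2 mevalM meval_linform -expr2; congr (_ - _).
rewrite /sqnorm (raddf_sum (meval _)) /=; apply: eq_bigr => i _.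
by rewrite expr2 mevalM mevalXU.
Qed.

Lemma ddir_linform v w : ddir v (linform w) = (dot w v)%:MP.
Proof.
rewrite /ddir vfield_linform (raddf_sum (@mpolyC d R)); apply: eq_bigr => i _.
by rewrite -mpolyCM.
Qed.

Lemma euler_linform w : euler (linform w) = linform w.
Proof. exact: vfield_linform. Qed.

Lemma ddir_axial_sqdist v b :
  ddir v (axial_sqdist b) = 2 * linform v - 2 * linform b * (dot b v)%:MP.
Proof.
rewrite /axial_sqdist /ddir vfieldB vfield_sqnorm expr2 vfieldM -/(ddir v _).
by rewrite ddir_linform -/(linform v); ring.
Qed.

Lemma euler_axial_sqdist b : euler (axial_sqdist b) = 2 * axial_sqdist b.
Proof.
rewrite /axial_sqdist /euler vfieldB vfield_sqnorm expr2 vfieldM -/(euler _).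
rewrite euler_linform /sqnorm; under eq_bigr do rewrite -expr2.
by ring.
Qed.

Lemma mderiv_axial_sqdist b i :
  (axial_sqdist b)^`M(i) = 2 * ('X_i - linform b * (b 0 i)%:MP).
Proof. by rewrite mderivB mderiv_sqnorm expr2 mderivM mderiv_linform; ring. Qed.

(** The constant is twice the dimension n = d - 1 of the hyperplane orthogonal to
    b; this is where the index d - 1 of the Gegenbauer polynomials enters. *)
Lemma laplacian_axial_sqdist b : dot b b = 1 ->
  laplacian (axial_sqdist b) = (2 * (d%:R - 1))%:MP.
Proof.
move=> b1; rewrite /laplacian.
under eq_bigr => i _.
  rewrite mderiv_axial_sqdist -[2]/(2%:R) mulr_natl mderivMn mderivB mderivM.
  rewrite mderivXU eqxx mderivC mderiv_linform mulr0 addr0 -mpolyCM -mpolyCB.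
  rewrite -mpolyCMn; over.
rewrite -(raddf_sum (@mpolyC d R)) /=; congr _%:MP.
by rewrite sumrMnl sumrB sumr_const card_ord -/(dot b b) b1 mulr_natl.
Qed.

Lemma mderiv_axial_sqdist_grad b p :
  \sum_i (axial_sqdist b)^`M(i) * p^`M(i)
    = 2 * (euler p - linform b * ddir b p).
Proof.
rewrite /euler /ddir /vfield mulr_sumr -sumrB mulr_sumr; apply: eq_bigr => i _.
by rewrite mderiv_axial_sqdist; ring.
Qed.

Hypothesis d_ge3 : (3 <= d)%N.
Variable b : 'rV[R]_d.
Hypothesis b1 : dot b b = 1.

Definition zonal_solid k w : {mpoly R[d]} :=
  solid d.-1 (linform w) ((dot w w)%:MP * axial_sqdist b) k.

Let n_ge2 : (2 <= d.-1)%N.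
Proof. by rewrite -ltnS prednK // (ltn_trans _ d_ge3). Qed.

Section Orthogonal.
Variables (w : 'rV[R]_d).
Hypothesis bw : dot b w = 0.

Lemma ddir_axis_zonal_solid k : ddir b (zonal_solid k w) = 0.
Proof.
apply: vfield_solid0; rewrite -/(ddir b _); first by rewrite ddir_linform dotC bw mpolyC0.
rewrite /ddir vfieldM vfieldC -/(ddir b _) ddir_axial_sqdist b1 mpolyC1.
by ring.
Qed.

Lemma euler_zonal_solid k : euler (zonal_solid k w) = k%:R%:MP * zonal_solid k w.
Proof.
apply: euler_solid => //; first exact: euler_linform.
by rewrite /euler vfieldM vfieldC -/(euler _) euler_axial_sqdist; ring.
Qed.

Lemma ddir_zonal_solid k :
  ddir w (zonal_solid k.+1 w) = (k.+1%:R * dot w w)%:MP * zonal_solid k w.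
Proof.
apply: ddir_solid => //; first exact: ddir_linform.
rewrite /ddir vfieldM vfieldC -/(ddir w _) ddir_axial_sqdist bw mpolyC0.
by ring.
Qed.

(** Taking the Laplacian of the recurrence for degree k + 2, with n = d - 1,
    leaves 2 (2k + n) times the derivative of the term of degree k + 1 along w,
    minus (k + 1) |w|^2 (2n + 4k) times the term of degree k, and these cancel
    by [ddir_zonal_solid]. *)
Lemma laplacian_zonal_solid k : laplacian (zonal_solid k w) = 0.
Proof.
have L1 : laplacian (1 : {mpoly R[d]}) = 0.
  by rewrite /laplacian big1 // => i _; rewrite -mpolyC1 !mderivC.
suff: laplacian (zonal_solid k w) = 0 /\ laplacian (zonal_solid k.+1 w) = 0 by case.
elim: k => [|k [IH0 IH1]]; first by split => //; exact: laplacian_linform.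
split=> //; apply: (@solid_denomI R d d.-1 n_ge2 k); rewrite mulr0 -laplacianZ.
rewrite solid_rec // laplacianB !laplacianZ -!/(zonal_solid _ w) laplacianM IH1.
rewrite laplacian_linform -mulrA laplacianZ laplacianM IH0.
rewrite laplacian_axial_sqdist // mderiv_axial_sqdist_grad.
rewrite ddir_axis_zonal_solid euler_zonal_solid.
rewrite mderiv_linform_grad ddir_zonal_solid.
have -> : d%:R = (d.-1)%:R + 1 :> R by rewrite natr1 prednK // (ltn_trans _ d_ge3).
by ring.
Qed.

End Orthogonal.

(** Only the leading term of the first factor survives against a harmonic second
    factor, and its power of a linear form evaluates the second factor at w. *)
Lemma zonal_solid_gram k : exists2 c : R, 0 < c &
  forall w w', dot b w = 0 -> dot b w' = 0 ->
  fischer k (zonal_solid k w) (zonal_solid k w') = c * (zonal_solid k w').@[w 0].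
Proof.
have [c c0 hc] := @solid_lead R d d.-1 n_ge2 k.
exists (c * k`!%:R ^+ 2) => [|w w' bw bw'].
  by rewrite mulr_gt0 // exprn_gt0 // ltr0n fact_gt0.
have [r E] := hc (linform w) ((dot w w)%:MP * axial_sqdist b).
rewrite [zonal_solid k w]E fischerDl fischerZl.
rewrite fischer_linform_pow; last exact: euler_zonal_solid.
rewrite -(mulrA _ (axial_sqdist b)) fischerZl fischer_harmonic ?mulr0 ?addr0 ?mulrA //.
  exact: laplacian_zonal_solid.
exact: ddir_axis_zonal_solid.
Qed.

Lemma meval_zonal_solid k c c' : dot c c = 1 -> dot c' c' = 1 ->
  (zonal_solid k (orthoproj b c')).@[orthoproj b c 0] =
    zonal d k (dot b c) (dot b c') (dot c c').
Proof.
move=> c1 c1'; rewrite meval_solid; apply: eq_bigr => j _.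
rewrite meval_linform mevalM mevalC meval_axial_sqdist !dot_orthoproj //.
rewrite dot_axis_orthoproj // c1 c1' (dotC c') (mulrC (dot b c')).
by congr (_ * _ * _ ^+ _); ring.
Qed.

(** Schoenberg's theorem in the hyperplane orthogonal to b: up to a positive
    factor the quadratic form is the Fischer square of a linear combination. *)
Lemma zonal_kernel_psd k (s : seq 'rV[R]_d) (f : 'rV[R]_d -> R) :
  {in s, forall c, dot c c = 1} ->
  0 <= \sum_(c <- s) \sum_(c' <- s)
         f c * f c' * zonal d k (dot b c) (dot b c') (dot c c').
Proof.
move=> s1; have [a a0 gram] := zonal_solid_gram k.
pose F c := zonal_solid k (orthoproj b c).
rewrite -(pmulr_rge0 _ a0).
suff -> : a * \sum_(c <- s) \sum_(c' <- s)
         f c * f c' * zonal d k (dot b c) (dot b c') (dot c c')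
   = fischer k (\sum_(c <- s) (f c)%:MP * F c) (\sum_(c <- s) (f c)%:MP * F c).
  exact: fischer_ge0.
rewrite fischer_suml mulr_sumr; apply: eq_big_seq => c cs.
rewrite fischerZl fischerC fischer_suml !mulr_sumr; apply: eq_big_seq => c' cs'.
rewrite fischerZl fischerC gram ?dot_axis_orthoproj // meval_zonal_solid ?s1 //.
by ring.
Qed.

End ZonalKernel.

(** * Sums over inner products as sums over points *)

Section Distances.
Variables (R : realType) (d : nat) (X : {fset 'rV[R]_d}).
Hypothesis X_sphere : {in X, forall c, dot c c = 1}.
Variable V : lmodType R.

Lemma dot_eq0 (v : 'rV[R]_d) : dot v v = 0 -> v = 0.
Proof.
move=> v0; apply/rowP => i; rewrite mxE; apply/eqP; rewrite -sqrf_eq0 expr2.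
move: (psumr_eq0P (fun i _ => sqr_ge0 (v 0 i)) v0) => /(_ i isT) /eqP.
by rewrite expr2.
Qed.

(** Equality case of Cauchy-Schwarz: here |c - c'|^2 = 2 - 2 (c.c') = 0. *)
Lemma dot_unit_eq1 (c c' : 'rV[R]_d) :
  dot c c = 1 -> dot c' c' = 1 -> dot c c' = 1 -> c = c'.
Proof.
move=> h h' h1; apply/eqP; rewrite -subr_eq0; apply/eqP/dot_eq0.
by rewrite dotBl ![dot _ (c - _)]dotC !dotBl (dotC c') h h' h1; ring.
Qed.

Lemma mem_inner_products c c' : c \in X -> c' \in X ->
  (dot c c' \in inner_products X) = (c' != c).
Proof.
move=> cX c'X; apply/imfsetP/idP => [[[a a'] /=]|cc'].
  rewrite !inE /= => /andP[/andP[aX a'X] aa'] e.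
  apply: contra aa' => /eqP cc'; rewrite cc' X_sphere // in e.
  by apply/eqP/dot_unit_eq1; rewrite ?X_sphere.
by exists (c, c') => //; rewrite !inE /= cX c'X eq_sym.
Qed.

Lemma sum_fsetM (T T' : choiceType) (W : nmodType) (A : {fset T})
    (B : {fset T'}) (F : T * T' -> W) :
  \sum_(p <- (A `*` B)%fset) F p = \sum_(a <- A) \sum_(b <- B) F (a, b).
Proof. by rewrite big_imfset2 //= => -[a b] [a' b'] _ _ /= [-> ->]. Qed.

Lemma card_fset_sep (T : choiceType) (A : {fset T}) (P : pred T) :
  #|` [fset p in A | P p]%fset| = (\sum_(p <- A) P p)%N.
Proof.
rewrite card_fset_sum1 big_fset /= big_mkcond.
by apply: eq_bigr => p _; case: (P p).
Qed.

Lemma pair_countE t :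
  (pair_count X t)%:R = \sum_(c <- X) \sum_(c' <- X) (dot c c' == t)%:R :> R.
Proof. by rewrite /pair_count card_fset_sep natr_sum sum_fsetM. Qed.

Lemma triple_countE u v t :
  (triple_count X u v t)%:R =
    \sum_(b <- X) \sum_(c <- X) \sum_(c' <- X)
      (dot b c == u)%:R * (dot b c' == v)%:R * (dot c c' == t)%:R :> R.
Proof.
rewrite /triple_count card_fset_sep natr_sum !sum_fsetM.
do 3!apply: eq_bigr => ? _.
by rewrite /= -!natrM !mulnb andbA.
Qed.

Lemma sum_eq_scale (s : seq R) (a : R) (F : R -> V) : uniq s ->
  \sum_(t <- s) (a == t)%:R *: F t = if a \in s then F a else 0.
Proof.
move=> us; case: ifP => [ain|/negP ain].
  rewrite (bigD1_seq a) //= eqxx scale1r big1 ?addr0 // => t ta.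
  by rewrite eq_sym (negPf ta) scale0r.
rewrite big1_seq // => t /andP[_ ts]; case: eqP => [e|_]; last exact: scale0r.
by case: ain; rewrite e.
Qed.

Lemma sum_pair_count (F : R -> V) :
  \sum_(t <- inner_products X) (pair_count X t)%:R *: F t =
    \sum_(c <- X) \sum_(c' <- X | c' != c) F (dot c c').
Proof.
under eq_bigr => t _.
  rewrite pair_countE scaler_suml.
  under eq_bigr do rewrite scaler_suml.
  over.
rewrite exchange_big; apply: eq_big_seq => c cX /=.
rewrite exchange_big [RHS]big_mkcond; apply: eq_big_seq => c' c'X /=.
by rewrite sum_eq_scale ?fset_uniq // mem_inner_products.
Qed.

(** The values of F lie in an arbitrary module so that this serves both the
    scalar identity and the matrix. *)
Lemma sum_triple_count (F : R -> R -> R -> V) :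
  \sum_(u <- inner_products X) \sum_(v <- inner_products X)
    \sum_(t <- inner_products X) (triple_count X u v t)%:R *: F u v t =
  \sum_(b <- X) \sum_(c <- X | c != b) \sum_(c' <- X | (c' != b) && (c' != c))
    F (dot b c) (dot b c') (dot c c').
Proof.
transitivity (\sum_(b <- X) \sum_(c <- X) \sum_(c' <- X)
  \sum_(u <- inner_products X) \sum_(v <- inner_products X)
    \sum_(t <- inner_products X) (dot b c == u)%:R *: ((dot b c' == v)%:R *:
       ((dot c c' == t)%:R *: F u v t))).
  under [RHS]eq_bigr => b _.
    under eq_bigr => c _.
      rewrite exchange_big; under eq_bigr => u _.
        rewrite exchange_big; under eq_bigr do rewrite exchange_big.
        over.
      over.
    rewrite exchange_big; under eq_bigr => u _.
      rewrite exchange_big; under eq_bigr do rewrite exchange_big.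
      over.
    over.
  rewrite [RHS]exchange_big; apply: eq_bigr => u _.
  rewrite [RHS]exchange_big; apply: eq_bigr => v _.
  rewrite [RHS]exchange_big; apply: eq_bigr => t _.
  rewrite triple_countE scaler_suml; apply: eq_bigr => b _.
  rewrite scaler_suml; apply: eq_bigr => c _.
  by rewrite scaler_suml; apply: eq_bigr => c' _; rewrite -!scalerA.
apply: eq_big_seq => b bX; rewrite [RHS]big_mkcond; apply: eq_big_seq => c cX.
transitivity (if c != b then
  \sum_(c' <- X) \sum_(v <- inner_products X) \sum_(t <- inner_products X)
   (dot b c' == v)%:R *: ((dot c c' == t)%:R *: F (dot b c) v t) else 0).
  pose H u := \sum_(c' <- X) \sum_(v <- inner_products X)
    \sum_(t <- inner_products X)
      (dot b c' == v)%:R *: ((dot c c' == t)%:R *: F u v t).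
  rewrite -mem_inner_products // -(sum_eq_scale _ H) ?fset_uniq //.
  rewrite exchange_big; apply: eq_bigr => u _; rewrite !scaler_sumr.
  apply: eq_bigr => c' _; rewrite scaler_sumr; apply: eq_bigr => v _.
  by rewrite scaler_sumr.
case: ifP => // _; rewrite [RHS]big_mkcond; apply: eq_big_seq => c' c'X.
under eq_bigr => v _ do
  rewrite -scaler_sumr sum_eq_scale ?fset_uniq // mem_inner_products //.
by rewrite sum_eq_scale ?fset_uniq // mem_inner_products //; case: (c' != b).
Qed.

(** The second sum gathers the triples with exactly two equal entries; each of
    the three patterns is indexed by its ordered pair of distinct points. *)
Lemma sum_triple_split (G : 'rV[R]_d -> 'rV[R]_d -> 'rV[R]_d -> V) :
  \sum_(b <- X) \sum_(c <- X) \sum_(c' <- X) G b c c' =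
  \sum_(b <- X) G b b b
  + \sum_(b <- X) \sum_(c <- X | c != b) (G b b c + G b c b + G b c c)
  + \sum_(b <- X) \sum_(c <- X | c != b)
      \sum_(c' <- X | (c' != b) && (c' != c)) G b c c'.
Proof.
rewrite -!big_split; apply: eq_big_seq => b bX /=.
rewrite (bigD1_seq b) ?fset_uniq //= (bigD1_seq b) ?fset_uniq //= -!addrA.
congr (_ + _); rewrite !big_split /= -!addrA; congr (_ + _).
rewrite -!big_split /= [LHS]big_seq_cond [RHS]big_seq_cond; apply: eq_bigr => c /andP[cX cb].
rewrite (bigD1_seq b) ?fset_uniq //=; congr (_ + _).
rewrite big_mkcond (bigD1_seq c) ?fset_uniq //= cb; congr (_ + _).
by rewrite -big_mkcondr; apply: eq_bigl => c'; rewrite andbC.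
Qed.

End Distances.

(** * The theorem *)

Lemma zonalC (R : realType) (d k : nat) (u v t : R) :
  zonal d k u v t = zonal d k v u t.
Proof.
by rewrite /zonal (mulrC v) (mulrC (1 - v ^+ 2)).
Qed.

Lemma quad_form_delta (R : comNzRingType) (m : nat) (z : 'cV[R]_m) (a : R) (i j : 'I_m) :
  (z^T *m (a *: (delta_mx i 0 *m (delta_mx j 0 : 'cV[R]_m)^T)) *m z) 0 0
    = z i 0 * z j 0 * a.
Proof.
rewrite -scalemxAr -scalemxAl mxE trmx_delta !mulmxA -colE -mulmxA -rowE.
by rewrite mxE big_ord1 !mxE mulrC.
Qed.

Local Open Scope fset_scope.

Theorem theorem2p3 (R : realType) (d s : nat) (X : {fset 'rV[R]_d})
    (hd : (3 <= d)%N) (hX : spherical_distance_set s X) :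
  let A := inner_products X in
  let N : R := #|` X|%:R in
  let x (t : R) : R := (pair_count X t)%:R in
  let y (u v t : R) : R := (triple_count X u v t)%:R in
  let Q := @zonal R d in
  (\sum_(u <- A) \sum_(v <- A) \sum_(t <- A) y u v t
     = (N - 2) * \sum_(t <- A) x t) /\
  (forall idx : R -> 'I_s.+1, {in 1 |` A &, injective idx} ->
   let e (u : R) : 'cV[R]_s.+1 := delta_mx (idx u) 0 in
   forall k : nat,
   psdmx
     ((N * Q k 1 1 1) *: (e 1 *m (e 1)^T)
      + \sum_(t <- A) x t *:
          (Q k 1 t t *: (e 1 *m (e t)^T)
           + Q k t 1 t *: (e t *m (e 1)^T)
           + Q k t t 1 *: (e t *m (e t)^T))
      + \sum_(u <- A) \sum_(v <- A) \sum_(t <- A)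
          (y u v t * Q k u v t) *: (e u *m (e v)^T))).
Proof.
move=> A N x y Q; have [sphX _] := hX.
have X1 : {in X, forall c, dot c c = 1} by move=> c /sphX; rewrite inE => /eqP.
split=> [|idx _ e k].
  transitivity (\sum_(u <- A) \sum_(v <- A) \sum_(t <- A) y u v t *: (1 : R^o)).
    by do 3!apply: eq_bigr => ? _; rewrite [RHS]mulr1.
  transitivity ((N - 2) * \sum_(t <- A) x t *: (1 : R^o)); last first.
    by congr (_ * _); apply: eq_bigr => ? _; rewrite [LHS]mulr1.
  rewrite sum_triple_count // sum_pair_count // mulr_sumr.
  apply: eq_big_seq => b bX; rewrite mulr_sumr [LHS]big_seq_cond [RHS]big_seq_cond.
  apply: eq_bigr => c /andP[cX cb].
  (* Removing b and c from the sum that counts X leaves N - 2. *)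
  have : \sum_(c' <- X) (1 : R) = N by rewrite big_const_seq count_predT iter_addr_0.
  rewrite (bigD1_seq b) ?fset_uniq //= big_mkcond (bigD1_seq c) ?fset_uniq //= cb.
  rewrite -big_mkcondr => <-; rewrite mulr1.
  under eq_bigl do rewrite andbC.
  by ring.
pose G (b c c' : 'rV[R]_d) : 'M[R]_s.+1 :=
  Q k (dot b c) (dot b c') (dot c c') *: (e (dot b c) *m (e (dot b c'))^T).
set M := (X in psdmx X).
have {M}-> : M = \sum_(b <- X) \sum_(c <- X) \sum_(c' <- X) G b c c'.
  rewrite sum_triple_split /M; congr (_ + _ + _)%R.
  - rewrite -scalerA scaler_nat -[LHS]iter_addr_0 -[size _]count_predT -big_const_seq.
    by apply: eq_big_seq => b bX; rewrite /G X1.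
  - rewrite sum_pair_count //; apply: eq_big_seq => b bX.
    rewrite [LHS]big_seq_cond [RHS]big_seq_cond; apply: eq_bigr => c /andP[cX _].
    by rewrite /G !X1 // (dotC c b).
  - under eq_bigr do under eq_bigr do under eq_bigr do rewrite -scalerA.
    by rewrite sum_triple_count.
split=> [|z].
  rewrite raddf_sum; apply: eq_bigr => b _ /=.
  rewrite raddf_sum exchange_big; apply: eq_bigr => c _ /=.
  rewrite raddf_sum; apply: eq_bigr => c' _ /=.
  by rewrite /G linearZ /= trmx_mul trmxK /Q zonalC (dotC c').
rewrite mulmx_sumr mulmx_suml summxE big_seq sumr_ge0 // => b bX.
apply: le_trans (zonal_kernel_psd hd (X1 b bX) k (fun c => z (idx (dot b c)) 0) X1) _.
rewrite mulmx_sumr mulmx_suml summxE le_eqVlt; apply/orP; left; apply/eqP.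
apply: eq_bigr => c _; rewrite mulmx_sumr mulmx_suml summxE; apply: eq_bigr => c' _.
by rewrite quad_form_delta.
Qed.
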